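(* Let $\lambda<\kappa$ be infinite regular cardinals and $\mathbb S$ a nonreflecting stationary subset of $E^\kappa_\lambda$. If there exists a strongly unbounded coloring $c:\lambda\times\kappa\rightarrow\lambda$, then there exist a club $C\subseteq\kappa$ and a matrix $\langle A^i_\alpha\mid\alpha\in\mathbb S\cap C,\ i<\lambda\rangle$ such that: (1) for every $\alpha\in\mathbb S\cap C$, $\langle A^i_\alpha\mid i<\lambda\rangle$ is a sequence of pairwise disjoint cofinal subsets of $\alpha$; (2) for every stationary $S\subseteq\mathbb S$, there are stationarily many $\alpha\in S\cap C$ such that $\sup(A^i_\alpha\cap S)=\alpha$ for all $i<\lambda$; (3) for all $\alpha<\alpha'$ in $\mathbb S\cap C$ and all $i,i'<\lambda$, $\sup(A^i_\alpha\cap A^{i'}_{\alpha'})<\alpha$. Moreover, if $\kappa=\lambda^+$ or $\lambda^{<\lambda}=\lambda$, one can take $C=\kappa$.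
   Context: $E^\kappa_\lambda=\{\alpha<\kappa\mid\mathrm{cf}(\alpha)=\lambda\}$. A stationary $S\subseteq\kappa$ is nonreflecting if there is no $\alpha<\kappa$ of uncountable cofinality with $S\cap\alpha$ stationary in $\alpha$. For a coloring $c:\lambda\times\kappa\rightarrow\lambda$ and $\beta<\kappa$, $c_\beta(\eta):=c(\eta,\beta)$; $c$ is strongly unbounded iff for every cofinal $B\subseteq\kappa$ there are $\eta<\lambda$ and $t:\eta\to\lambda$ with $\sup\{c_\beta(\eta)\mid\beta\in B,\ c_\beta\restriction\eta=t\}=\lambda$. *)

(* Defs.v *)
From HB Require Import structures.
From mathcomp Require Import all_boot all_order.
From mathcomp Require Import boolp classical_sets functions cardinality wochoice.

Set Implicit Arguments.
Unset Strict Implicit.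
Unset Printing Implicit Defensive.
Import Order.TTheory.
Local Open Scope order_scope.
Local Open Scope classical_set_scope.
Local Open Scope card_scope.

(* Ordinals are the elements of an arbitrary well-ordered type O, and an
   ordinal alpha, viewed as the set of smaller ordinals, is [seg alpha]. Since
   O is arbitrary (for instance of order type kappa + 1), every ordinal kappa
   is covered. All notions below only depend on the segment below the largest
   ordinal they mention, not on the rest of O.
   Maps between ordinals are total maps on O of which only the values on the
   intended domain matter. *)
Section Ordinals.
Context {d : Order.disp_t} {O : orderType d}.
Implicit Types (alpha beta mu nu kappa lambda : O) (X S C B : set O).

Definition seg alpha : set O := [set x | x < alpha].

Definition cofinal_in alpha X : Prop :=
  X `<=` seg alpha /\
  forall x, x < alpha -> exists2 y, X y & x <= y.

Definition cofinal_map mu alpha (f : O -> O) : Prop :=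
  set_fun (seg mu) (seg alpha) f /\ cofinal_in alpha (f @` seg mu).

(* cf(alpha) = mu *)
Definition has_cf alpha mu : Prop :=
  (exists f, cofinal_map mu alpha f) /\
  forall nu, (exists f, cofinal_map nu alpha f) -> mu <= nu.

Definition uncountable_cf alpha : Prop :=
  exists2 mu, has_cf alpha mu & ~ countable (seg mu).

Definition is_cardinal kappa : Prop :=
  forall mu, mu < kappa -> ~ (seg mu #= seg kappa).

Definition infinite_regular kappa : Prop :=
  [/\ is_cardinal kappa, infinite_set (seg kappa) & has_cf kappa kappa].

(* kappa = lambda^+ *)
Definition is_successor_cardinal lambda kappa : Prop :=
  [/\ is_cardinal kappa, lambda < kappa &
      forall mu, is_cardinal mu -> lambda < mu -> kappa <= mu].

(* lambda^{<lambda} = lambda, where lambda^{<lambda} is the cardinality of the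
   set of all functions from some eta < lambda to lambda *)
Definition weak_power_eq lambda : Prop :=
  [set: {eta : seg lambda & seg (val eta) -> seg lambda}] #= seg lambda.

(* E^kappa_lambda *)
Definition cf_points kappa lambda : set O :=
  [set alpha | alpha < kappa /\ has_cf alpha lambda].

(* [supremums X] is the set of least upper bounds of X, so that
   [supremums X s] reads sup X = s, with sup of the empty set equal to 0 *)
Definition club kappa C : Prop :=
  cofinal_in kappa C /\
  forall beta, beta < kappa -> seg beta !=set0 ->
    supremums (C `&` seg beta) beta -> C beta.

Definition stationary kappa S : Prop :=
  S `<=` seg kappa /\ forall C, club kappa C -> S `&` C !=set0.

Definition nonreflecting kappa S : Prop :=
  ~ exists alpha, [/\ alpha < kappa, uncountable_cf alpha &
                      stationary alpha (S `&` seg alpha)].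

Definition coloring lambda kappa (c : O -> O -> O) : Prop :=
  forall eta beta, eta < lambda -> beta < kappa -> c eta beta < lambda.

Definition strongly_unbounded lambda kappa (c : O -> O -> O) : Prop :=
  forall B, cofinal_in kappa B ->
    exists eta (t : O -> O),
      [/\ eta < lambda, set_fun (seg eta) (seg lambda) t &
          supremums
            [set c eta beta | beta in
               [set beta | B beta /\ forall xi, xi < eta -> c xi beta = t xi]]
            lambda].

(* Clauses (1)-(3) for the matrix A alpha i = A^i_alpha, of which only the
   entries with alpha in SS `&` C and i < lambda matter. *)
Definition guessing_matrix lambda kappa (SS C : set O) (A : O -> O -> set O)
    : Prop :=
  [/\ forall alpha, (SS `&` C) alpha ->
        (forall i, i < lambda -> cofinal_in alpha (A alpha i)) /\
        trivIset (seg lambda) (A alpha),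
      forall S, S `<=` SS -> stationary kappa S ->
        stationary kappa
          [set alpha | (S `&` C) alpha /\
             forall i, i < lambda -> supremums (A alpha i `&` S) alpha] &
      forall alpha alpha', (SS `&` C) alpha -> (SS `&` C) alpha' ->
        alpha < alpha' ->
        forall i i', i < lambda -> i' < lambda ->
          exists2 s, supremums (A alpha i `&` A alpha' i') s & s < alpha].

End Ordinals.

(* Main.v *)
Require Import Defs.
From mathcomp Require Import all_boot all_order.
From mathcomp Require Import boolp classical_sets functions cardinality wochoice.
Import Order.TTheory.
Local Open Scope order_scope.
Local Open Scope classical_set_scope.

Set Implicit Arguments.
Unset Strict Implicit.
Unset Printing Implicit Defensive.

(** Fix for every [al] in [SS] a ladder of type [lambda], write [h al be] for the
    index of its first point [a al be] above [be], and write [Delta be al] for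
    the first place where the columns [D be] and [D al] of the colouring differ.
    The matrix puts [be] in [A al i] when both [h al be] and [phi (a al be) be]
    are at most [D al (Delta be al)]. Nonreflection provides, for every [ga],
    functions [phi ga] tending to [lambda] at all points of [SS] up to [ga];
    since either [Delta be al <= Delta al al'] or [Delta be al' = Delta al al'],
    this makes the sets almost disjoint. The colour [i] is read off from [be],
    [a al be] and the threshold [D be (Delta be al)]: near a point [de] of [SS]
    it is the class of [de] in a fixed partition of [SS] into [lambda] many
    stationary sets.

    To guess a stationary [S], Fodor's lemma makes the ladder data of the
    [al] in [S] relative to a given [de] constant; strong unboundedness gives a
    node [t] below which the values [D al n] of these [al] are unbounded; and a
    second use of Fodor's lemma makes [t] independent of [de]. Any [be] in [S]
    through [t] and close to a suitable [de] is then caught by an [al] with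
    [D al n] large. This needs fewer than [kappa] many nodes and distinct
    columns, which is achieved by truncating and re-indexing the colouring.

    Ladders of ordinals outside [SS] are added to make every [A al i] cofinal,
    so that the club can be taken to be all of [kappa]. *)

Lemma choice_in (T U : Type) (u0 : U) (C : T -> Prop) (P : T -> U -> Prop) :
  (forall x, C x -> exists y, P x y) ->
  exists f : T -> U, forall x, C x -> P x (f x).
Proof.
move=> H; suff [f Pf] : {f : T -> U & forall x, C x -> P x (f x)} by exists f.
apply: (@boolp.choice _ _ (fun x y => C x -> P x y)) => x.
by have [/H[y Py]|nC] := pselect (C x); [exists y | exists u0].
Qed.

(** * Well-ordered types: least elements, recursion, suprema, cofinality *)

Section WellOrder.
Context {d : Order.disp_t} {O : orderType d}.
Hypothesis O_wo : well_order (fun x y : O => x <= y).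
Implicit Types (x y z u v w al be ga mu nu : O) (X K P S : set O).

Lemma ex_least P : P !=set0 -> exists2 m, P m & forall x, P x -> m <= x.
Proof.
case=> x0 Px0.
have /O_wo[m [[mP lbm] _]] : nonempty [pred x | `[<P x>]].
  by exists x0; apply/asboolP.
exists m => [|x Px]; first by move/asboolP: mP.
by apply: lbm; apply/asboolP.
Qed.

Lemma wo_ind (P : O -> Prop) :
  (forall x, (forall y, y < x -> P y) -> P x) -> forall x, P x.
Proof.
move=> IH x; apply: contrapT => nPx.
have [m nPm lem] := @ex_least [set y | ~ P y] (ex_intro _ x nPx).
apply: nPm; apply: IH => y ltym; apply: contrapT => /lem.
by rewrite leNgt ltym.
Qed.

Definition least (x0 : O) P := xget x0 [set m | P m /\ forall x, P x -> m <= x].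

Lemma leastP x0 P : P !=set0 -> P (least x0 P) /\ forall x, P x -> least x0 P <= x.
Proof.
move=> /ex_least[m Pm mle].
by apply: (@xgetPex _ x0 [set m | P m /\ forall x, P x -> m <= x]); exists m.
Qed.

Lemma wf_rec (F : O -> (O -> O) -> O) :
  (forall x f g, (forall y, y < x -> f y = g y) -> F x f = F x g) ->
  exists f : O -> O, forall x, f x = F x f.
Proof.
move=> Fext.
have wf : well_founded (fun x y : O => x < y).
  by apply: wo_ind => x IH; constructor.
(* The value [x] outside the segment is a placeholder; [Fext] makes it irrelevant. *)
pose G x (r : forall y, y < x -> O) : O :=
  F x (fun y => if pselect (y < x) is left h then r y h else x).
exists (Fix wf (fun=> O) G) => x.
rewrite Fix_eq.
  by apply: Fext => y ltyx; case: pselect.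
move=> y r s rs; congr (F y _); apply/funext => z; case: pselect => // h.
Qed.

Lemma ex_sup X u : (forall x, X x -> x <= u) ->
  exists2 s, supremums X s & s <= u.
Proof.
move=> Xu; have [s sub sle] := @ex_least (ubound X) (ex_intro _ u Xu).
by exists s; [split | exact: sle].
Qed.

Lemma supremums_gt X s x : supremums X s -> x < s -> exists2 y, X y & x < y.
Proof.
move=> [_ lb] ltxs; apply: contrapT => H.
have /lb : ubound X x.
  by move=> y Xy; rewrite leNgt; apply/negP => ltxy; apply: H; exists y.
by rewrite leNgt ltxs.
Qed.

(** The minimality half of [has_cf al mu], with strict bounds so that, for [mu] at least 2, it also
    makes [al] a limit. *)
Definition small_bounded mu al := forall nu (f : O -> O), nu < mu ->
  (forall k, k < nu -> f k < al) ->
  exists2 x, x < al & forall k, k < nu -> f k < x.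

Lemma has_cf_small_bounded al mu : has_cf al mu -> small_bounded mu al.
Proof.
move=> [_ mumin] nu f ltnm fal; apply: contrapT => H.
suff /mumin : exists f, cofinal_map nu al f by rewrite leNgt ltnm.
exists f; split; first by move=> k /= /fal.
split; first by move=> _ [k /= /fal ? <-].
move=> x ltxal; apply: contrapT => H'; apply: H; exists x => // k ltk.
rewrite ltNge; apply/negP => lexf; apply: H'; exists (f k) => //.
Qed.

Lemma small_bounded_le mu al nu (f : O -> O) : small_bounded mu al ->
  nu < mu -> (forall k, k <= nu -> f k < al) ->
  exists2 x, x < al & forall k, k <= nu -> f k <= x.
Proof.
move=> sb ltnm fal.
have [x ltx fx] := sb nu f ltnm (fun k ltk => fal k (ltW ltk)).
exists (Order.max x (f nu)); first by rewrite gt_max ltx fal.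
move=> k; rewrite le_eqVlt => /orP[/eqP->|/fx/ltW lex].
  by rewrite le_max lexx orbT.
by rewrite le_max lex.
Qed.

Lemma small_bounded_limit mu al x : small_bounded mu al ->
  (exists u v, u < v /\ v < mu) -> x < al -> exists2 y, x < y & y < al.
Proof.
move=> sb [u [v [ltuv ltvm]]] ltx.
have [y lty H] := sb v (fun=> x) ltvm (fun _ _ => ltx).
by exists y => //; apply: H ltuv.
Qed.

End WellOrder.

(** * Infinite regular cardinals *)

Section Regular.
Context {d : Order.disp_t} {O : orderType d}.
Hypothesis O_wo : well_order (fun x y : O => x <= y).
Context {lambda : O}.
Hypothesis lambda_reg : infinite_regular lambda.
Implicit Types (x y z u v w al be ga mu nu i k : O) (X K P S : set O).

Let lambda_sb : small_bounded lambda lambda.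
Proof. by case: lambda_reg => _ _ /has_cf_small_bounded. Qed.

Lemma lambda_nat : exists2 f : nat -> O,
  (forall n, f n < lambda) & injective f.
Proof.
have [_ /infiniteP/card_leP[f] _] := lambda_reg.
exists (fun n => val (f (to_setT n))) => [n|m n /val_inj].
  exact: (set_mem (valP (f (to_setT n)))).
move=> /(@inj _ _ _ f) H; have: to_setT m = to_setT n by apply: H; rewrite in_setT.
by move=> /(congr1 val).
Qed.

Lemma lambda_ge2 : exists u v, u < v /\ v < lambda.
Proof.
have [f flt finj] := lambda_nat.
have [lt01|lt10|/finj//] := ltgtP (f 0%N) (f 1%N).
  by exists (f 0%N), (f 1%N).
by exists (f 1%N), (f 0%N).
Qed.

Lemma lambda_limit x : x < lambda -> exists2 y, x < y & y < lambda.
Proof. exact: small_bounded_limit lambda_sb lambda_ge2. Qed.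

(** Since [lambda] is infinite, [nat] embeds in it, and the sequence can be reindexed by
    [lambda < kappa]. *)
Lemma nat_bounded kappa (f : nat -> O) : small_bounded kappa kappa ->
  lambda < kappa -> (forall n, f n < kappa) ->
  exists2 x, x < kappa & forall n, f n < x.
Proof.
move=> sb ltlk flt; have [g glt ginj] := lambda_nat.
pose inv k := xget 0%N [set n | g n = k].
have [x ltx fx] := sb lambda (fun k => f (inv k)) ltlk (fun k _ => flt _).
exists x => // n; have := fx (g n) (glt n).
suff -> : inv (g n) = n by [].
by apply: ginj; apply: (@xgetPex _ 0%N [set m | g m = g n]); exists n.
Qed.

(* The elements [a x i] for [i <= y] and [x = s y] form the [y]-th of a
   sequence of consecutive blocks in [K], and the [i]-th element of every block
   long enough gets the value [i]. *)
Lemma unbounded_fibers K :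
  (forall v, v < lambda -> exists2 k, K k & v <= k /\ k < lambda) ->
  exists g : O -> O, forall i v, i < lambda -> v < lambda ->
    exists k, [/\ K k, v <= k, k < lambda & g k = i].
Proof.
move=> Kunb.
have Kst x : x < lambda -> exists2 k, K k & x < k /\ k < lambda.
  move=> /lambda_limit[y ltxy /Kunb[k Kk [leyk ltk]]]; exists k => //.
  by split=> //; apply: lt_le_trans leyk.
pose Q x i (f : O -> O) := [set y | [/\ K y, x <= y & forall j, j < i -> f j < y]].
have Qext x i f g : (forall j, j < i -> f j = g j) -> Q x i f = Q x i g.
  move=> fg; apply/seteqP.
  by split=> y [? ? H]; split=> // j ltj; [rewrite -fg | rewrite fg] => //; apply: H.
have Qn0 x i f : x < lambda -> i < lambda -> (forall j, j < i -> f j < lambda) ->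
    Q x i f (least lambda (Q x i f)) /\ least lambda (Q x i f) < lambda.
  move=> ltx lti flt; have [y lty fy] := lambda_sb lti flt.
  have /Kst[k Kk [ltk ltkl]] : Order.max x y < lambda by rewrite gt_max ltx lty.
  have Qk : Q x i f k.
    move: ltk; rewrite gt_max => /andP[ltxk ltyk].
    by split=> //; [exact: ltW | move=> j /fy /lt_trans; apply].
  have [H1 H2] := leastP O_wo lambda (ex_intro _ k Qk).
  by split=> //; apply: le_lt_trans (H2 _ Qk) ltkl.
have [a aE] : {a : O -> O -> O &
    forall x i, a x i = least lambda (Q x i (a x))}.
  apply: (@boolp.choice _ _ (fun x ax => forall i, ax i = least lambda (Q x i ax))).
  by move=> x; apply: wf_rec => // i f g /Qext ->.
have aP x i : x < lambda -> i < lambda -> Q x i (a x) (a x i) /\ a x i < lambda.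
  move=> ltx; elim/(wo_ind O_wo): i => i IH lti; rewrite aE; apply: Qn0 => // j ltj.
  by apply: (IH j ltj _).2; apply: lt_trans lti.
have a_mono x i j : x < lambda -> i < lambda -> j <= i -> a x j <= a x i.
  move=> ltx lti; rewrite le_eqVlt => /orP[/eqP->//|ltji].
  by apply/ltW; have [[_ _ H] _] := aP _ _ ltx lti; apply: H.
(* Block [y] starts at or above [s y], hence beyond [a (s z) z], the last element of each earlier
   block [z]; by [y <= s y] the blocks climb to [lambda]. *)
pose R y (s : O -> O) := [set x | y <= x /\ forall z, z < y -> a (s z) z < x].
have Rext y f g : (forall j, j < y -> f j = g j) -> R y f = R y g.
  move=> fg; apply/seteqP.
  by split=> x [? H]; split=> // j ltj; [rewrite -fg | rewrite fg] => //; apply: H.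
have [s sE] : exists s : O -> O, forall y, s y = least lambda (R y s).
  by apply: wf_rec => // y f g /Rext ->.
have sP y : y < lambda -> R y s (s y) /\ s y < lambda.
  elim/(wo_ind O_wo): y => y IH lty; rewrite sE.
  have [z ltz az] : exists2 z, z < lambda & forall k, k < y -> a (s k) k < z.
    apply: lambda_sb => // k ltk.
    by apply: (aP _ _ _ _).2; [apply: (IH k ltk _).2 |]; apply: lt_trans lty.
  have Rz : R y s (Order.max y z).
    split=> [|k /az ltk]; first by rewrite le_max lexx.
    by rewrite lt_max ltk orbT.
  have [H1 H2] := leastP O_wo lambda (ex_intro _ _ Rz).
  by split=> //; apply: le_lt_trans (H2 _ Rz) _; rewrite gt_max lty ltz.
pose G k := [set i | exists y, [/\ i <= y, y < lambda & k = a (s y) i]].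
have Guniq k i j : G k i -> G k j -> i = j.
  suff sep y z i' j' : i' <= y -> y < z -> z < lambda -> a (s y) i' < a (s z) j' \/ ~ j' < lambda.
    move=> [y [liy ly ->]] [z [ljz lz]] e.
    have li := le_lt_trans liy ly; have lj := le_lt_trans ljz lz.
    have [ltyz|ltzy|eyz] := ltgtP y z.
    - by case: (sep y z i j) => //; rewrite e ltxx.
    - by case: (sep z y j i) => //; rewrite e ltxx.
    rewrite -eyz in e; have [_ lsy] := sP _ ly.
    have [ltij|ltji|//] := ltgtP i j.
    - have [[_ _ /(_ i ltij)]] := aP _ _ lsy lj; by rewrite e ltxx.
    - have [[_ _ /(_ j ltji)]] := aP _ _ lsy li; by rewrite e ltxx.
  move=> leiy ltyz ltz; have [ltj|] := pselect (j' < lambda); [left|by right].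
  have [[_ H] ltsz] := sP _ ltz; have [[_ lesa _] _] := aP _ _ ltsz ltj.
  apply: lt_le_trans lesa; apply: le_lt_trans (H _ ltyz).
  have lty := lt_trans ltyz ltz.
  by apply: a_mono => //; exact: (sP _ lty).2.
exists (fun k => xget lambda (G k)) => i v lti ltv.
(* Block [y] has an [i]-th element as [i <= y], and lies above [v] as [v <= y]. *)
pose y := Order.max i v.
have lty : y < lambda by rewrite gt_max lti ltv.
have [[leys _] ltsy] := sP _ lty; have [[Ka lesa _] lta] := aP _ _ ltsy lti.
exists (a (s y) i); split=> //.
  by apply: le_trans lesa; apply: le_trans leys; rewrite le_max lexx orbT.
have Gi : G (a (s y) i) i by exists y; split=> //; rewrite le_max lexx.
by apply: (Guniq (a (s y) i)) => //; apply: xgetPex; exists i.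
Qed.

End Regular.

(** * Clubs, stationary sets and Fodor's lemma *)

Section Stationary.
Context {d : Order.disp_t} {O : orderType d}.
Hypothesis O_wo : well_order (fun x y : O => x <= y).
Context {lambda kappa : O}.
Hypothesis lambda_reg : infinite_regular lambda.
Hypothesis kappa_reg : infinite_regular kappa.
Hypothesis lambda_lt_kappa : lambda < kappa.
Implicit Types (x y z u v w al be ga mu nu i k : O) (X K P S B C : set O).

Let kappa_sb : small_bounded kappa kappa.
Proof. by case: kappa_reg => _ _ /has_cf_small_bounded. Qed.

Let kappa_limit x : x < kappa -> exists2 y, x < y & y < kappa.
Proof. exact: lambda_limit. Qed.

Definition maps_seg (F : O -> O) := forall x, x < kappa -> F x < kappa.

Definition closed_under (F : O -> O) al := forall x, x < al -> F x < al.

(** Regularity of [kappa] is applied over [y <= z] for each [x], then over [x <= z]. Closure under a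
    two-variable function thus reduces to closure under a one-variable one. *)
Lemma maps_seg_majorant (F : O -> O -> O) x0 :
  (forall x y, x < kappa -> y < kappa -> F x y < kappa) -> x0 < kappa ->
  exists2 G, maps_seg G & forall z, z < kappa ->
    [/\ z < G z, x0 < G z & forall x y, x <= z -> y <= z -> F x y < G z].
Proof.
move=> Fk x0k.
suff /(choice_in x0)[G GP] : forall z, z < kappa -> exists w, [/\ w < kappa, z < w,
    x0 < w & forall x y, x <= z -> y <= z -> F x y < w].
  by exists G => z /GP[].
move=> z zk.
have /(choice_in x0)[b bP] : forall x, x < kappa -> exists w,
    w < kappa /\ forall y, y <= z -> F x y <= w.
  move=> x xk.
  have [y yk yP] := small_bounded_le (f := F x) kappa_sb zk
    (fun y leyz => Fk x y xk (le_lt_trans leyz zk)).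
  by exists y.
have [u uk uP] := small_bounded_le (f := b) kappa_sb zk
    (fun y leyz => (bP y (le_lt_trans leyz zk)).1).
have /kappa_limit[w] : Order.max u (Order.max z x0) < kappa.
  by rewrite !gt_max uk zk.
rewrite !gt_max => /and3P[ltuw ltzw ltxw] wk; exists w; split=> // x y lexz leyz.
apply: le_lt_trans ltuw; apply: le_trans (uP _ lexz).
by apply: (bP _ _).2 => //; apply: le_lt_trans zk.
Qed.

(** Together with [club_closed_under], this lets nonzero closure points of functions stand for
    arbitrary clubs. A closure point above [x0] is the supremum of the iterates at [x0] of a
    majorant of [F]; it is below [kappa] since [kappa] has uncountable cofinality. *)
Lemma closed_under_club F : maps_seg F ->
  club kappa [set al | [/\ al < kappa, seg al !=set0 & closed_under F al]].
Proof.
move=> Fk; split; first split.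
- by move=> al [].
- move=> x0 x0k.
  have [G Gk GP] := @maps_seg_majorant (fun x _ => F x) x0 (fun x y xk _ => Fk x xk) x0k.
  have yk n : iter n G x0 < kappa by elim: n => //= n; exact: Gk.
  have [u uk uP] := nat_bounded lambda_reg kappa_sb lambda_lt_kappa yk.
  have [s ssup sle] : exists2 s, supremums [set iter n G x0 | n in [set: nat]] s & s <= u.
    by apply: ex_sup => // _ [n _ <-]; apply/ltW/uP.
  have ys n : iter n G x0 < s.
    have [/(_ (iter n.+1 G x0)) H _] := ssup.
    apply: lt_le_trans (H _); last by exists n.+1.
    by have [] := GP _ (yk n).
  exists s; last exact/ltW/(ys 0%N).
  split; first exact: le_lt_trans sle uk.
    by exists x0; exact: (ys 0%N).
  move=> x ltxs; have [_ [n _ <-] ltx] := supremums_gt ssup ltxs.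
  apply: lt_trans (ys n.+1); have [_ _ H] := GP _ (yk n).
  exact: H (ltW ltx) (lexx _).
move=> be bek be0 besup; split=> // x ltx.
have [y [[_ _ yF] ltyb] ltxy] := supremums_gt besup ltx.
by apply: lt_trans ltyb; apply: yF.
Qed.

(** Let [F x] be a point of [C] above [x]; nonzero closure points of [F] are then limits of [C]. *)
Lemma club_closed_under C : club kappa C -> exists2 F, maps_seg F &
  forall al, al < kappa -> seg al !=set0 -> closed_under F al -> C al.
Proof.
move=> [[Ck Ccof] Ccl].
have /(choice_in kappa)[F FP] : forall x, x < kappa -> exists y, C y /\ x < y.
  move=> x /kappa_limit[y ltxy yk].
  by have [z Cz leyz] := Ccof _ yk; exists z; split=> //; apply: lt_le_trans leyz.
exists F => [x /FP[/Ck //]|al alk al0 alF]; apply: Ccl => //; split.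
  by move=> y [_ /ltW].
move=> u ubu; rewrite leNgt; apply/negP => ltu.
have [CF ltuF] := FP u (lt_trans ltu alk).
have /ubu : (C `&` seg al) (F u) by split=> //; apply: alF.
by rewrite leNgt ltuF.
Qed.

Lemma stationary_intro S : S `<=` seg kappa ->
  (forall F, maps_seg F -> exists al, [/\ S al, seg al !=set0 & closed_under F al]) ->
  stationary kappa S.
Proof.
move=> Sk H; split=> // C /club_closed_under[F Fk FC].
by have [al [Sal al0 alF]] := H F Fk; exists al; split=> //; apply: FC => //; apply: Sk.
Qed.

Lemma stationary_sub S S' : S `<=` S' -> S' `<=` seg kappa ->
  stationary kappa S -> stationary kappa S'.
Proof.
by move=> SS' S'k [_ st]; split=> // C /st[al [/SS' ? ?]]; exists al.
Qed.

Lemma stationary_closed S (F : O -> O -> O) x0 : stationary kappa S ->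
  (forall x y, x < kappa -> y < kappa -> F x y < kappa) -> x0 < kappa ->
  exists al, [/\ S al, x0 < al & forall x y, x < al -> y < al -> F x y < al].
Proof.
move=> [Sk Sst] Fk x0k; have [G Gk GP] := maps_seg_majorant Fk x0k.
have [al [Sal [alk [z ltz] alG]]] := Sst _ (closed_under_club Gk).
have Gl x : x < al -> G x < al by apply: alG.
exists al; split=> //.
  by have [_ + _] := GP z (lt_trans ltz alk); move=> /lt_trans; apply; apply: Gl.
move=> x y ltx lty; have ltm : Order.max x y < al by rewrite gt_max ltx lty.
have [_ _ H] := GP _ (lt_trans ltm alk).
by apply: lt_trans (Gl _ ltm); apply: H; rewrite le_max lexx ?orbT.
Qed.

Lemma stationary_restrict S (F : O -> O -> O) x0 : stationary kappa S ->
  (forall x y, x < kappa -> y < kappa -> F x y < kappa) -> x0 < kappa ->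
  stationary kappa
    [set al | [/\ S al, x0 < al & forall x y, x < al -> y < al -> F x y < al]].
Proof.
move=> Sst Fk x0k; apply: stationary_intro => [al [Sal _ _]|G Gk].
  exact: Sst.1.
have := @stationary_closed S (fun x y => Order.max (F x y) (G x)) x0 Sst.
case=> // [x y xk yk|al [Sal lt0 alFG]]; first by rewrite gt_max Fk ?Gk.
exists al; split=> //; last first.
  by move=> x ltx; have := alFG x x ltx ltx; rewrite gt_max => /andP[].
  by exists x0.
by split=> // x y ltx lty; have := alFG x y ltx lty; rewrite gt_max => /andP[].
Qed.

Lemma stationary_above S x0 : stationary kappa S -> x0 < kappa ->
  stationary kappa [set al | S al /\ x0 < al].
Proof.
move=> Sst x0k; have := @stationary_restrict S (fun x _ => x) x0 Sst.
move=> /(_ (fun x y xk _ => xk) x0k)[sub st]; split=> [al [/Sst.1]//|C /st].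
by move=> [al [[? ? _] ?]]; exists al.
Qed.

Lemma stationary_cofinal S : stationary kappa S -> cofinal_in kappa S.
Proof.
move=> Sst; split; first exact: Sst.1.
move=> x xk; have := @stationary_closed S (fun x _ => x) x Sst.
by case=> // al [Sal /ltW ? _]; exists al.
Qed.

(** If every fibre of [g] missed the closure points of some [F xi], a point [al] of [S] above [ga0]
    and closed under the two-variable [F] would lie in the fibre of [g al < al] and be closed under
    [F (g al)]. Closure under [F] plays the part of a diagonal intersection. *)
Lemma fodor S ga0 (g : O -> O) : stationary kappa S -> ga0 < kappa ->
  (forall al, S al -> g al < al \/ g al < ga0) ->
  exists2 xi, xi < kappa & stationary kappa [set al | S al /\ g al = xi].
Proof.
move=> Sst ga0k gP; apply: contrapT => H.
have /(choice_in id)[F FP] : forall xi, xi < kappa -> exists F, maps_seg F /\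
    forall al, S al -> g al = xi -> seg al !=set0 -> ~ closed_under F al.
  move=> xi xik.
  apply: contrapT => H'; apply: H; exists xi => //.
  apply: stationary_intro => [al [/Sst.1]//|G Gk]; apply: contrapT => H''.
  by apply: H'; exists G; split=> // al Sal gal al0 alG; apply: H''; exists al.
have [al [Sal ltga alF]] := stationary_closed Sst (fun x y xk => (FP x xk).1 y) ga0k.
have ltg : g al < al by case: (gP _ Sal) => // /lt_trans; apply.
have [_] := FP (g al) (lt_trans ltg (Sst.1 _ Sal)).
move=> /(_ al Sal erefl); apply; first by exists ga0.
by move=> x ltx; apply: alF.
Qed.

Lemma cofinal_pigeonhole B nu (q : O -> O) : cofinal_in kappa B -> nu < kappa ->
  (forall y, B y -> q y < nu) ->
  exists2 v, v < nu & cofinal_in kappa [set y | B y /\ q y = v].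
Proof.
move=> [Bk Bcof] nuk qP; apply: contrapT => H.
have /(choice_in nu)[b bP] : forall v, v < nu -> exists b,
    b < kappa /\ forall y, B y -> b <= y -> q y <> v.
  move=> v ltv.
  apply: contrapT => H'; apply: H; exists v => //; split=> [y [/Bk]//|x xk].
  apply: contrapT => H''; apply: H'; exists x; split=> // y By lexy qy.
  by apply: H''; exists y.
have [x xk xP] := kappa_sb nuk (fun v ltv => (bP v ltv).1).
have [y By lexy] := Bcof _ xk.
by have [_ /(_ y By)] := bP _ (qP _ By); apply=> //; apply: le_trans lexy; apply/ltW/xP/qP.
Qed.

End Stationary.

(** * Ladders, and the functions obtained from nonreflection *)

Section Nonreflecting.
Context {d : Order.disp_t} {O : orderType d}.
Hypothesis O_wo : well_order (fun x y : O => x <= y).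
Context {lambda kappa : O} {SS : set O}.
Hypothesis lambda_reg : infinite_regular lambda.
Hypothesis SS_cf : SS `<=` cf_points kappa lambda.
Hypothesis SS_nonrefl : nonreflecting kappa SS.
Implicit Types (x y z u v w al be ga de xi mu nu i k : O) (X K P S B C : set O).

Let SS_sb de : SS de -> small_bounded lambda de.
Proof. by move=> /SS_cf[_ /has_cf_small_bounded]. Qed.

Lemma SS_limit de x : SS de -> x < de -> exists2 y, x < y & y < de.
Proof. by move=> /SS_sb sb; apply: small_bounded_limit sb _; exact: lambda_ge2. Qed.

Lemma SS_pos de : SS de -> seg de !=set0.
Proof.
move=> /SS_cf[_ [[f [fs _]] _]]; have [u [v [ltuv ltv]]] := lambda_ge2 lambda_reg.
by exists (f v); apply: fs.
Qed.

(* [h al be] is the index in a fixed ladder of [al] of the first point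
   [a al be] above [be]. *)
Definition is_ladder (h a : O -> O -> O) := forall al, SS al ->
  [/\ forall be, be < al -> [/\ h al be < lambda, be <= a al be, a al be < al &
        forall be', be' <= be -> h al be' <= h al be],
      forall v, v < lambda -> exists2 xi, xi < al &
        forall be, xi < be -> be < al -> v < h al be &
      forall de, SS de -> de < al -> exists2 xi, xi < de &
        forall be, xi < be -> be < de -> h al be = h al de /\ a al be = a al de].

(** The cofinal map [f al] need not be increasing, but the least index [h al be] of a value at or
    above [be] is monotone in [be]. Fewer than [lambda] values of [f al] are bounded in [al], and in
    any [de] of [SS] exceeding them, which gives the last two clauses. *)
Lemma ex_ladder : exists h a, is_ladder h a.
Proof.
have /(choice_in id)[f fP] : forall al, SS al -> exists f, cofinal_map lambda al f.
  by move=> al /SS_cf[_ []].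
pose h al be := least lambda [set k | k < lambda /\ be <= f al k].
have hP al be : SS al -> be < al -> [/\ h al be < lambda, be <= f al (h al be) &
    forall k, k < lambda -> be <= f al k -> h al be <= k].
  move=> /fP[_ [_ fcof]] /fcof[_ [k /= ltk <-] lebe].
  have [|[H1 H2] H3] := @leastP _ _ O_wo lambda [set k | k < lambda /\ be <= f al k].
    by exists k.
  by split=> // j ltj lej; apply: H3.
exists h, (fun al be => f al (h al be)) => al SSal; split.
- move=> be ltbe; have [H1 H2 _] := hP _ _ SSal ltbe; split=> //.
    by have [fs _] := fP _ SSal; apply: fs.
  move=> be' le'; have [_ _ H3] := hP _ _ SSal (le_lt_trans le' ltbe).
  by apply: H3 => //; apply: le_trans H2.
- move=> v ltv; have [fs _] := fP _ SSal.
  have [k lek|xi ltxi xiP] := small_bounded_le (f := f al) (SS_sb SSal) ltv.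
    by apply: fs => /=; apply: le_lt_trans ltv.
  exists xi => // be ltbe ltal; have [H1 H2 _] := hP _ _ SSal ltal.
  rewrite ltNge; apply/negP => /xiP.
  by move=> /(le_trans H2); rewrite leNgt ltbe.
- move=> de SSde ltde; have [H1 H2 H3] := hP _ _ SSal ltde.
  have [k ltk|xi ltxi xiP] := SS_sb SSde (f := f al) H1.
    rewrite ltNge; apply/negP => /(H3 _ (lt_trans ltk H1)).
    by rewrite leNgt ltk.
  exists xi => // be ltbe ltbede.
  suff -> : h al be = h al de by [].
  have [K1 K2 K3] := hP _ _ SSal (lt_trans ltbede ltde).
  apply/eqP; rewrite eq_le; apply/andP; split.
    by apply: K3 => //; apply: le_trans H2; exact: ltW.
  rewrite leNgt; apply/negP => /xiP/lt_le_trans/(_ (ltW ltbe)).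
  by rewrite ltNge K2.
Qed.

Lemma ex_has_cf ga : exists mu, has_cf ga mu.
Proof.
have [|mu [f fP] mumin] := ex_least O_wo (P := [set mu | exists f, cofinal_map mu ga f]).
  exists ga, id; split=> //; split=> [_ [x /= ? <-]//|x ltx].
  by exists x => //; exists x.
by exists mu; split; [exists f | move=> nu H; apply: mumin].
Qed.

(** If [ga] has uncountable cofinality, nonreflection gives a club of [ga] missing [SS], and [nu be]
    is its next point. Otherwise a cofinal set is enumerated by [nat], and [nu be] is its first
    listed point at or above [be]. *)
Lemma locally_constant_step ga : ga < kappa -> exists nu : O -> O,
  (forall be, be < ga -> be <= nu be /\ nu be < ga) /\
  forall de, SS de -> de < ga -> exists2 xi, xi < de &
    forall be, xi < be -> be < de -> nu be = nu de.
Proof.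
move=> gak; have [mu mucf] := ex_has_cf ga.
have [[f [fs [_ fcof]]] _] := mucf.
have [/countable_injP[g ginj]|munc] := pselect (countable (seg mu)); last first.
  have : ~ stationary ga (SS `&` seg ga).
    by move=> st; apply: SS_nonrefl; exists ga; split=> //; exists mu.
  move=> /not_andP[[]|/existsNP[C /not_implyP[[[Cga Ccof] Ccl] Cdis]]].
    by move=> ? [].
  pose nu be := least ga [set y | C y /\ be <= y].
  have nuP be : be < ga -> [/\ C (nu be), be <= nu be &
      forall y, C y -> be <= y -> nu be <= y].
    move=> /Ccof[y Cy ley].
    have [|[H1 H2] H3] := @leastP _ _ O_wo ga [set y | C y /\ be <= y].
      by exists y.
    by split=> // z Cz lez; apply: H3.
  exists nu; split=> [be /nuP[/Cga ? ? _] //|de SSde ltde].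
  (* Otherwise [de] would belong to [C]; so [C] is bounded below [de], and its next point is
     eventually constant there. *)
  have nsup : ~ supremums (C `&` seg de) de.
    move=> sup; apply: Cdis; exists de; split; first by split.
    by apply: Ccl => //; exact: SS_pos.
  have [xi ltxi xiP] : exists2 xi, xi < de & forall y, C y -> y < de -> y <= xi.
    apply: contrapT => H; apply: nsup; split=> [y [_ /ltW]//|u ubu].
    rewrite leNgt; apply/negP => ltu; apply: H; exists u => // y Cy lty.
    by apply: ubu.
  exists xi => // be ltbe ltbede.
  have [H1 H2 H3] := nuP _ (lt_trans ltbede ltde); have [K1 K2 K3] := nuP _ ltde.
  apply/eqP; rewrite eq_le H3 ?(le_trans (ltW ltbede))//=; apply: K3 => //.
  rewrite leNgt; apply/negP => /(xiP _ H1) /(le_trans H2).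
  by rewrite leNgt ltbe.
pose Q be := [set n | exists2 k, k < mu & be <= f k /\ g k = n].
have QP be : be < ga -> exists k, [/\ k < mu, be <= f k &
    forall j, j < mu -> be <= f j -> (g k <= g j)%N].
  move=> /fcof[_ [k /= ltk <-] lebe].
  have Q0 : exists n, `[< Q be n >] by exists (g k); apply/asboolP; exists k.
  have [n /asboolP[j ltj [lej <-]] nmin] := ex_minnP Q0.
  by exists j; split=> // l ltl lel; apply: nmin; apply/asboolP; exists l.
have {QP}/(choice_in ga)[q qP] := QP.
exists (f \o q); split=> [be /qP[ltq leq _]|de SSde ltde].
  by split=> //; apply: fs.
have [H1 H2 H3] := qP _ ltde.
have [xi ltxi xiP] : exists2 xi, xi < de &
    forall k, k < mu -> (g k < g (q de))%N -> f k <= xi.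
  (* Only finitely many indices are listed before [q de]; the maximum of their values stays below
     [de]. *)
  have : forall k, k < mu -> (g k < g (q de))%N -> f k < de.
    move=> k ltk ltg; rewrite ltNge; apply/negP => /(H3 _ ltk).
    by rewrite leqNgt ltg.
  elim: (g (q de)) => [_|n IH Hn].
    by have [x ltx] := SS_pos SSde; exists x.
  have [k ltk ltg|xi ltxi xiP] := IH; first by apply: Hn => //; apply: ltnW.
  have [[k ltk gk]|nk] := pselect (exists2 k, k < mu & g k = n).
    exists (Order.max xi (f k)); first by rewrite gt_max ltxi Hn// gk.
    move=> j ltj; rewrite ltnS leq_eqVlt => /orP[/eqP gj|ltgj].
      have -> : j = k by apply: ginj; rewrite ?inE ?gj.
      by rewrite le_max lexx orbT.
    by rewrite le_max xiP.
  exists xi => // j ltj; rewrite ltnS leq_eqVlt => /orP[/eqP gj|ltgj].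
    by case: nk; exists j.
  exact: xiP.
exists xi => // be ltbe ltbede /=; congr f.
have [K1 K2 K3] := qP _ (lt_trans ltbede ltde).
apply: ginj; rewrite ?inE //; apply/eqP; rewrite eqn_leq K3//=; last first.
  by apply: le_trans H2; apply: ltW.
rewrite leqNgt; apply/negP => /(xiP _ K1)/(le_trans K2).
by rewrite leNgt ltbe.
Qed.

(* [phi] tends to [lambda] at every point of [SS] up to [ga]. For [be] close to
   such a point [de], the colour of [de] is recovered from [be], [ga] and any
   large enough threshold [w <= h de be]. *)
Definition separates (h : O -> O -> O) (col : O -> O) ga
    (phi : O -> O) (p : O -> O -> O) :=
  (forall be, phi be < lambda) /\
  forall de, SS de -> de <= ga ->
    (forall v, v < lambda -> exists2 xi, xi < de &
      forall be, xi < be -> be < de -> v < phi be) /\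
    exists xi wb, [/\ xi < de, wb < lambda &
      forall be w, xi < be -> be < de -> wb <= w -> w <= h de be ->
        p be w = col de].

(** By induction, [be] uses the functions of stage [nu be < ga]. Near [de < ga] in [SS] this is the
    fixed stage [nu de >= de]. If [ga] is in [SS], [h ga] is merged into [phi], and thresholds up to
    [h ga be] return the colour of [ga]. *)
Lemma ex_separates h a col ga : is_ladder h a -> ga < kappa ->
  exists phi p, separates h col ga phi p.
Proof.
move=> lad; elim/(wo_ind O_wo): ga => ga IH gak.
have [nu [nuP nuc]] := locally_constant_step gak.
have [u0 [v0 [ltuv ltv]]] := lambda_ge2 lambda_reg.
have lt0 := lt_trans ltuv ltv.
have {IH}/(choice_in (id, fun _ => id))[F FP] : forall ga', ga' < ga -> exists fp,
    separates h col ga' fp.1 fp.2.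
  by move=> ga' lt'; have [phi [p H]] := IH _ lt' (lt_trans lt' gak); exists (phi, p).
pose phi1 be := if be < ga then (F (nu be)).1 be else u0.
pose p1 be w := (F (nu be)).2 be w.
pose phi be := if `[< SS ga >] && (be < ga) then Order.max (phi1 be) (h ga be) else phi1 be.
pose p be w := if `[< SS ga >] && (w <= h ga be) then col ga else p1 be w.
have phi1l be : phi1 be < lambda.
  by rewrite /phi1; case: ifP => // /nuP[_ /FP[]].
exists phi, p; split.
  move=> be; rewrite /phi; case: ifP => // /andP[/asboolP SSga ltbe].
  by rewrite gt_max phi1l; have [/(_ _ ltbe)[]] := lad _ SSga.
move=> de SSde; rewrite le_eqVlt => /orP[/eqP ede|ltde].
  rewrite /phi /p -ede; have [_ hlim _] := lad _ SSde; split.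
    move=> v /hlim[xi ltxi xiP]; exists xi => // be ltbe ltbed.
    by rewrite ltbed (asboolT SSde) /= lt_max xiP ?orbT.
  have [x ltx] := SS_pos SSde; exists x, u0; split=> // be w _ _ _ lew.
  by rewrite (asboolT SSde) lew.
have [xi1 lt1 xi1P] := nuc _ SSde ltde.
have [lenu ltnu] := nuP _ ltde.
have [_ /(_ _ SSde lenu)[Hphi [xi3 [wb [lt3 ltwb Hp]]]]] := FP _ ltnu.
have phi1E be : xi1 < be -> be < de -> phi1 be = (F (nu de)).1 be.
  by move=> ltbe ltbed; rewrite /phi1 (lt_trans ltbed ltde) xi1P.
split.
  move=> v /Hphi[xi2 lt2 xi2P]; exists (Order.max xi1 xi2); first by rewrite gt_max lt1.
  move=> be; rewrite gt_max => /andP[ltb1 ltb2] ltbed; rewrite /phi phi1E//.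
  by case: ifP => _; rewrite ?lt_max xi2P.
have [SSga|nSS] := pselect (SS ga); last first.
  exists (Order.max xi1 xi3), wb; split=> //; first by rewrite gt_max lt1.
  move=> be w; rewrite gt_max => /andP[ltb1 ltb3] ltbed lew1 lew2.
  by rewrite /p (asboolF nSS) /= /p1 xi1P// Hp.
have [hP _ /(_ _ SSde ltde)[xi4 lt4 xi4P]] := lad _ SSga.
(* Near [de], [h ga] has the constant value [h ga de < w'], so thresholds from [w'] on avoid the new
   case of [p]. *)
have [/lambda_limit-/(_ lambda_reg)[w' ltw' ltw'l] _ _ _] := hP _ ltde.
exists (Order.max xi1 (Order.max xi3 xi4)), (Order.max wb w'); split.
- by rewrite !gt_max lt1 lt3.
- by rewrite gt_max ltwb.
move=> be w; rewrite !gt_max ge_max => /and3P[ltb1 ltb3 ltb4] ltbed /andP[lew1 lew2] lewh.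
have [hE _] := xi4P _ ltb4 ltbed.
rewrite /p hE [w <= _]leNgt (lt_le_trans ltw' lew2) andbF /p1 xi1P//.
exact: Hp.
Qed.

End Nonreflecting.

(** * Truncating and re-indexing the colouring *)

Section Coloring.
Context {d : Order.disp_t} {O : orderType d}.
Hypothesis O_wo : well_order (fun x y : O => x <= y).
Context {lambda kappa : O}.
Hypothesis lambda_reg : infinite_regular lambda.
Hypothesis kappa_reg : infinite_regular kappa.
Hypothesis lambda_lt_kappa : lambda < kappa.
Implicit Types (x y z u v w al be ga ze xi eta mu nu i k n m r : O) (X B : set O).

Let kappa_sb : small_bounded kappa kappa.
Proof. by case: kappa_reg => _ _ /has_cf_small_bounded. Qed.

Definition agree n (f g : O -> O) := forall xi, xi < n -> f xi = g xi.

(* A strongly unbounded colouring whose splitting nodes are all among the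
   fewer than [kappa] many nodes [t ze] for [ze < ga0]. *)
Definition tight_coloring (D : O -> O -> O) (t : O -> O -> O) eta ga0 (e : O -> O) :=
  [/\ eta <= lambda /\ ga0 < kappa,
      forall n be, n < lambda -> be < kappa -> D be n < lambda,
      forall B, cofinal_in kappa B -> exists n ze, [/\ n < eta, ze < ga0 &
        forall v, v < lambda -> exists2 be, B be & agree n (D be) (t ze) /\ v < D be n],
      maps_seg (kappa := kappa) e &
      forall al al', al < al' -> al' < kappa -> closed_under e al' ->
        ~ agree eta (D al) (D al')].

(** Take [eta] least such that the restrictions of the columns to [eta] are not all represented
    below some [ga < kappa]. Nodes of length below [eta] are then represented below one [ga0], while
    columns new at length [eta] are cofinal; [e x] is the index of one at or above [x]. *)
Lemma ex_tight_coloring c : coloring lambda kappa c ->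
  strongly_unbounded lambda kappa c ->
  exists D t eta ga0 e, tight_coloring D t eta ga0 e.
Proof.
move=> cP cunb.
pose c' be eta := c eta be.
pose small eta := exists2 ga, ga < kappa & forall be, be < kappa ->
  exists2 be', be' < ga & agree eta (c' be') (c' be).
have unbP B : cofinal_in kappa B -> exists n t, n < lambda /\
    forall v, v < lambda -> exists2 be, B be & agree n (c' be) t /\ v < c' be n.
  move=> /cunb[n [t [ltn _ sup]]]; exists n, t; split=> // v ltv.
  have [_ [be [Bbe bet] <-] ltv'] := supremums_gt sup ltv.
  by exists be.
(* Otherwise cofinally many columns would coincide with a single one below [lambda], and their
   values at any level would be bounded. *)
have nsmall : ~ small lambda.
  move=> [ga gak gaP].
  have /(choice_in ga)[q qP] : forall be, be < kappa -> exists be',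
      be' < ga /\ agree lambda (c' be') (c' be).
    by move=> be /gaP[be' ? ?]; exists be'.
  have kcof : cofinal_in kappa (seg kappa).
    by split=> // x xk; exists x.
  have [|v ltv vcof] := cofinal_pigeonhole kappa_reg (q := q) kcof gak.
    by move=> y /= /qP[].
  have [n [t [ltn nP]]] := unbP _ vcof.
  have ltc : c' v n < lambda by apply: cP => //; apply: lt_trans gak.
  have [be [/= bek qbe] [_]] := nP _ ltc.
  by have [_ /(_ _ ltn)] := qP _ bek; rewrite qbe => ->; rewrite ltxx.
have [|eta [leeta neta] etamin] :=
    ex_least O_wo (P := [set eta | eta <= lambda /\ ~ small eta]).
  by exists lambda.
have smallP n : n < eta -> small n.
  move=> ltn; apply: contrapT => ns.
  have := etamin n; rewrite leNgt ltn => H; suff: false by []; apply: H; split=> //.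
  by apply: ltW; apply: lt_le_trans leeta.
have /(choice_in lambda)[G GP] : forall n, n < eta -> exists ga, ga < kappa /\
    forall be, be < kappa -> exists2 be', be' < ga & agree n (c' be') (c' be).
  by move=> n /smallP[ga ? ?]; exists ga.
have [ga0 ga0k ga0P] := kappa_sb (le_lt_trans leeta lambda_lt_kappa)
  (fun n ltn => (GP n ltn).1).
pose R := [set r | r < kappa /\ forall be, be < r -> ~ agree eta (c' be) (c' r)].
have Rcof x : x < kappa -> exists2 r, R r & x <= r.
  move=> xk; have [be bek beP] : exists2 be, be < kappa &
      forall be', be' < x -> ~ agree eta (c' be') (c' be).
    apply: contrapT => H; apply: neta; exists x => // be bek.
    apply: contrapT => H'; apply: H; exists be => // be' lt' ag.
    by apply: H'; exists be'.
  have [|r [lerb ag] rmin] := ex_least O_wo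
      (P := [set r | r <= be /\ agree eta (c' r) (c' be)]).
    by exists be; split.
  exists r.
    split; first exact: le_lt_trans bek.
    move=> z ltzr agz; suff: r <= z by rewrite leNgt ltzr.
    apply: rmin; split; first by apply: le_trans lerb; exact: ltW.
    by move=> xi ltxi; rewrite agz// ag.
  by rewrite leNgt; apply/negP => /beP; apply.
have {Rcof}/(choice_in kappa)[e eP] : forall x, x < kappa -> exists r, R r /\ x <= r.
  by move=> x /Rcof[r ? ?]; exists r.
exists (fun be => c' (e be)), c', eta, ga0, e; split=> //.
- by move=> n be ltn /eP[[ek _] _]; apply: cP.
- move=> B [Bk Bcof].
  have eBcof : cofinal_in kappa [set e be | be in B].
    split; first by move=> _ [be /Bk/eP[[]] ? _ _ <-].
    move=> x /Bcof[y By lexy]; exists (e y); first by exists y.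
    by apply: le_trans lexy _; have [] := eP _ (Bk _ By).
  have [n [t [ltn nP]]] := unbP _ eBcof.
  have [u0 [_ [/lt_trans H /H{H} ltu0]]] := lambda_ge2 lambda_reg.
  have [_ [be0 Bbe0 <-] [ag0 _]] := nP _ ltu0.
  have [[e0k e0R] _] := eP _ (Bk _ Bbe0).
  (* If [n >= eta], the columns through the node agree below [eta]; being first of their kind, they
     have the same index, hence a single value at [n]. *)
  have [ltne|leen] := ltP n eta.
    have [ze ltze zeag] := (GP n ltne).2 _ e0k.
    exists n, ze; split=> //; first by apply: lt_trans (ga0P _ ltne).
    move=> v /nP[_ [be Bbe <-] [agbe ltv]]; exists be => //; split=> // xi ltxi.
    by rewrite agbe// zeag// ag0.
  have ltc : c' (e be0) n < lambda by apply: cP.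
  have [_ [be Bbe <-] [agbe]] := nP _ ltc.
  suff -> : e be = e be0 by rewrite ltxx.
  have [[_ eR] _] := eP _ (Bk _ Bbe).
  have [lt1|lt2|//] := ltgtP (e be) (e be0).
    case: (e0R _ lt1) => xi ltxi; have ltxin := lt_le_trans ltxi leen.
    by rewrite agbe// ag0.
  case: (eR _ lt2) => xi ltxi; have ltxin := lt_le_trans ltxi leen.
  by rewrite agbe// ag0.
- by move=> x /eP[[]].
- move=> al al' ltal al'k al'e.
  have [[_ H] le'] := eP _ al'k.
  by apply: H; apply: lt_le_trans le'; apply: al'e.
Qed.

End Coloring.

(** * Stationary colour classes and the guessing relation *)

Section Guessing.
Context {d : Order.disp_t} {O : orderType d}.
Hypothesis O_wo : well_order (fun x y : O => x <= y).
Context {lambda kappa : O} {SS : set O}.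
Hypothesis lambda_reg : infinite_regular lambda.
Hypothesis kappa_reg : infinite_regular kappa.
Hypothesis lambda_lt_kappa : lambda < kappa.
Hypothesis SS_cf : SS `<=` cf_points kappa lambda.
Implicit Types (x y z u v w al be ga de ze xi i k n m : O) (X K S B : set O).

Let lambda_sb : small_bounded lambda lambda.
Proof. by case: lambda_reg => _ _ /has_cf_small_bounded. Qed.

Let kappa_sb : small_bounded kappa kappa.
Proof. by case: kappa_reg => _ _ /has_cf_small_bounded. Qed.

Let kappa_limit x : x < kappa -> exists2 y, x < y & y < kappa.
Proof. exact: lambda_limit. Qed.

Let SSk : SS `<=` seg kappa.
Proof. by move=> al /SS_cf[]. Qed.

Context {h a : O -> O -> O}.
Hypothesis lad : is_ladder (lambda := lambda) (SS := SS) h a.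

(** If, for some [x], unboundedly many [w] make [h al x = w] on a stationary set, [unbounded_fibers]
    merges these sets into [lambda] classes. Otherwise each [x] has a bound [V x] with
    [h al x < V x] off a nonstationary set. *)
Lemma stationary_partition : stationary kappa SS -> exists col : O -> O,
  forall i, i < lambda -> stationary kappa [set al | SS al /\ col al = i].
Proof.
move=> SSst.
pose P x w := [set al | [/\ SS al, x < al & h al x = w]].
have Pk x w : P x w `<=` seg kappa by move=> al [/SSk].
suff [x xk xP] : exists2 x, x < kappa & forall v, v < lambda -> exists2 w,
    stationary kappa (P x w) & v <= w /\ w < lambda.
  have [g gP] := unbounded_fibers O_wo lambda_reg xP.
  exists (fun al => g (h al x)) => i lti.
  have [u [v [ltuv ltv]]] := lambda_ge2 lambda_reg.
  have [k [kst _ _ gk]] := gP _ _ lti ltv.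
  apply: stationary_sub kst => [al [SSal _ hal]|al [/SSk//]].
  by split=> //; rewrite hal.
apply: contrapT => H.
have /(choice_in lambda)[V VP] : forall x, x < kappa -> exists v, v < lambda /\
    forall w, v <= w -> w < lambda -> ~ stationary kappa (P x w).
  move=> x xk; apply: contrapT => H'; apply: H; exists x => // v ltv.
  apply: contrapT => H''; apply: H'; exists v; split=> // w lew ltw st.
  by apply: H''; exists w.
have /(choice_in id)[F FP] : forall x, x < kappa -> exists F, maps_seg (kappa := kappa) F /\
    forall al, SS al -> x < al -> V x <= h al x -> ~ closed_under F al.
  move=> x xk; apply: contrapT => H'; have [ltV nst] := VP _ xk.
  pose S := [set al | [/\ SS al, x < al & V x <= h al x]].
  have Sst : stationary kappa S.
    apply: (stationary_intro kappa_reg) => [al [/SSk//]|G Gk].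
    apply: contrapT => H''; apply: H'; exists G; split=> // al SSal ltx leV alG.
    by apply: H''; exists al; split=> //; exists x.
  have [|w wk wst] := fodor O_wo lambda_reg kappa_reg lambda_lt_kappa (g := h^~ x)
      Sst lambda_lt_kappa.
    by move=> al [SSal ltx _]; right; have [/(_ _ ltx)[]] := lad SSal.
  have [_ wcof] := stationary_cofinal O_wo lambda_reg kappa_reg lambda_lt_kappa wst.
  have [al [[SSal ltx leV] hal] _] := wcof _ xk.
  apply: (nst w); rewrite -?hal//; first by have [/(_ _ ltx)[]] := lad SSal.
  apply: stationary_sub wst; last exact: Pk.
  by move=> be [[? ? _] hbe]; split=> //; rewrite hbe.
have kcof : cofinal_in kappa (seg kappa) by split=> // x xk; exists x.
(* With [V] constantly [v] on a cofinal set, some [al] would have [h al < v] at points arbitrarily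
   close to [al], although [h al] tends to [lambda]. *)
have [|v ltv [_ vcof]] := cofinal_pigeonhole kappa_reg (q := V) kcof lambda_lt_kappa.
  by move=> x /VP[].
have {vcof}/(choice_in lambda)[N NP] : forall x, x < kappa ->
    exists y, [/\ y < kappa, V y = v & x <= y].
  by move=> x /vcof[y [yk Vy] ley]; exists y.
have [|al [SSal lt0 alFN]] := stationary_closed O_wo lambda_reg kappa_reg lambda_lt_kappa
    (F := fun x y => Order.max (F x y) (N x)) SSst _ lambda_lt_kappa.
  move=> x y xk yk; rewrite gt_max; have [_ ->//] := (FP _ xk, (FP _ xk).1 _ yk).
  by have [] := NP _ xk.
have [hP hlim _] := lad SSal.
have [xi ltxi xiP] := hlim _ ltv.
have [x ltx ltxal] := SS_limit lambda_reg SS_cf SSal ltxi.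
have [yk Vy lexy] := NP _ (lt_trans ltxal (SSk SSal)).
have ltNal : N x < al.
  by have := alFN _ _ ltxal ltxal; rewrite gt_max => /andP[].
have [_ /(_ al SSal ltNal)] := FP _ yk; apply.
  by rewrite Vy; apply/ltW/xiP => //; apply: lt_le_trans lexy.
by move=> z ltz; have := alFN _ _ ltNal ltz; rewrite gt_max => /andP[].
Qed.

Context {col : O -> O} {phi : O -> O -> O} {p : O -> O -> O -> O}.
Hypothesis sepP : forall ga, ga < kappa ->
  separates (lambda := lambda) (SS := SS) h col ga (phi ga) (p ga).
Context {D t : O -> O -> O} {eta ga0 : O} {e : O -> O}.
Hypothesis DP : tight_coloring (lambda := lambda) (kappa := kappa) D t eta ga0 e.

Definition guesses i be al := exists2 n, n < eta &
  [/\ agree n (D be) (D al), D be n <> D al n, h al be <= D al n,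
      phi (a al be) be <= D al n & p (a al be) be (D be n) = i].

Lemma guesses_inj i j be al : guesses i be al -> guesses j be al -> i = j.
Proof.
move=> [n ltn [agn neqn _ _ <-]] [m ltm [agm neqm _ _ <-]].
suff -> : n = m by [].
have [/agm//|/agn//|//] := ltgtP n m.
Qed.

(** Let [m] be the first difference of [D al] and [D al']. Close to [al], [h al be] exceeds every
    [D al n] with [n <= m], so [be] splits from [al] after [m] and from [al'] exactly at [m]. But
    [a al' be] is constant there, and its [phi] exceeds [D al' m]. *)
Lemma guesses_almost_disjoint al al' : SS al -> SS al' -> al < al' ->
  closed_under e al' -> exists2 u, u < al &
  forall be i j, be < al -> guesses i be al -> guesses j be al' -> be <= u.
Proof.
move=> SSal SSal' ltal al'e.
have [[leeta _] Dl _ _ Dinj] := DP.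
have alk := SSk SSal; have al'k := SSk SSal'.
have [m [ltm neqm] mmin] : exists2 m, m < eta /\ D al m <> D al' m &
    forall n, n < eta /\ D al n <> D al' n -> m <= n.
  apply: (ex_least O_wo (P := [set m | m < eta /\ D al m <> D al' m])).
  apply: contrapT => H; apply: (Dinj _ _ ltal al'k al'e) => n ltn.
  by apply: contrapT => neq; apply: H; exists n.
have ltml := lt_le_trans ltm leeta.
have agm : agree m (D al) (D al').
  move=> n ltn; apply: contrapT => neq; suff: m <= n by rewrite leNgt ltn.
  by apply: mmin; split=> //; apply: lt_trans ltm.
have [v ltv vP] := small_bounded_le (f := D al) lambda_sb ltml
  (fun n len => Dl n al (le_lt_trans len ltml) alk).
have [_ hlim _] := lad SSal.
have [xi1 lt1 xi1P] := hlim _ ltv.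
have [h'P _ /(_ _ SSal ltal)[xi2 lt2 xi2P]] := lad SSal'.
have [_ leag aglt _] := h'P _ ltal.
have [_ /(_ _ SSal leag)[/(_ _ (Dl m al' ltml al'k))[xi3 lt3 xi3P] _]] :=
  sepP (lt_trans aglt al'k).
exists (Order.max xi1 (Order.max xi2 xi3)); first by rewrite !gt_max lt1 lt2.
move=> be i j ltbe [n ltn [agn _ leh _ _]] [n' ltn' [agn' neq' _ lephi _]].
rewrite leNgt; apply/negP; rewrite !gt_max => /and3P[ltb1 ltb2 ltb3].
have ltmn : m < n.
  rewrite ltNge; apply/negP => /vP lev.
  by have := xi1P _ ltb1 ltbe; rewrite ltNge (le_trans leh lev).
have en : n' = m.
  have [lt|gt|//] := ltgtP n' m.
    by case: neq'; rewrite agn// ?agm//; apply: lt_trans ltmn.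
  by case: neqm; rewrite -agn// agn'.
move: lephi; have [_ ->] := xi2P _ ltb2 ltbe.
by rewrite en leNgt xi3P.
Qed.

Lemma guesses_stationary S i : S `<=` SS -> stationary kappa S -> i < lambda ->
  stationary kappa [set al | SS al /\ col al = i] ->
  exists be al, [/\ S be, S al, be < al & guesses i be al].
Proof.
move=> SSS Sst lti Pst.
have [[leeta ga0k] Dl Dunb _ _] := DP.
have [u0 [v0 [ltu0 ltv0]]] := lambda_ge2 lambda_reg.
have lt0 := lt_trans ltu0 ltv0.
pose X ze n w := [set be | [/\ S be, agree n (D be) (t ze) & D be n = w]].
have Sk : S `<=` seg kappa by move=> al /SSS/SSk.
have Xk ze n w : X ze n w `<=` seg kappa by move=> be [/Sk].
(* Each of these fewer than [kappa] many classes is cofinal or bounded. Beyond a common bound [x0],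
   a single member shows that its class is cofinal. *)
have [x0 x0k x0P] : exists2 x0, x0 < kappa & forall ze n w, ze < ga0 -> n < lambda ->
    w < lambda -> forall y, X ze n w y -> x0 <= y -> cofinal_in kappa (X ze n w).
  pose Q ze n w b := forall y, X ze n w y -> b <= y -> cofinal_in kappa (X ze n w).
  have H0 ze n w : exists b, b < kappa /\ Q ze n w b.
    have [Xc|nX] := pselect (cofinal_in kappa (X ze n w)).
      by exists lambda; split.
    apply: contrapT => H; apply: nX; split=> // x xk.
    apply: contrapT => H'; apply: H; exists x; split=> // y Xy lexy.
    by case: H'; exists y.
  have H1 ze n : exists b, b < kappa /\ forall w, w < lambda -> Q ze n w b.
    have /(choice_in lambda)[f fP] : forall w, True -> exists b, b < kappa /\ Q ze n w b.
      by move=> w _; exact: H0.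
    have [b bk bP] := kappa_sb lambda_lt_kappa (fun w _ => (fP w Logic.I).1).
    exists b; split=> // w ltw y Xy leb; apply: (fP w Logic.I).2 Xy _.
    by apply: le_trans leb; apply/ltW/bP.
  have H2 ze : exists b, b < kappa /\ forall n w, n < lambda -> w < lambda -> Q ze n w b.
    have /(choice_in lambda)[f fP] : forall n, True -> exists b, b < kappa /\
        forall w, w < lambda -> Q ze n w b.
      by move=> n _; exact: H1.
    have [b bk bP] := kappa_sb lambda_lt_kappa (fun w _ => (fP w Logic.I).1).
    exists b; split=> // n w ltn ltw y Xy leb; apply: (fP n Logic.I).2 Xy _ => //.
    by apply: le_trans leb; apply/ltW/bP.
  have /(choice_in lambda)[f fP] : forall ze, True -> exists b, b < kappa /\
      forall n w, n < lambda -> w < lambda -> Q ze n w b.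
    by move=> ze _; exact: H2.
  have [b bk bP] := kappa_sb ga0k (fun w _ => (fP w Logic.I).1).
  exists b => // ze n w ltze ltn ltw y Xy leb; apply: (fP ze Logic.I).2 Xy _ => //.
  by apply: le_trans leb; apply/ltW/bP.
have S0st : stationary kappa [set al | S al /\ x0 < al].
  exact: (stationary_above O_wo lambda_reg kappa_reg lambda_lt_kappa Sst x0k).
(* [q] lists a bound, a threshold, a level and a node, all to be fixed independently of [de]; [k]
   and [ga], the values of [h al] and [a al] just below [de], may vary with [de]. *)
pose good de (q : O * O * (O * O)) := [/\ [/\ q.1.1 < de, q.1.2 < lambda,
    q.2.1 < eta & q.2.2 < ga0] &
  exists k ga, [/\ k < lambda, ga < kappa,
    forall be w, q.1.1 < be -> be < de -> q.1.2 <= w -> w <= h de be ->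
      p ga be w = col de &
    forall v, v < lambda -> exists al, [/\ S al, x0 < al, de < al,
      forall be, q.1.1 < be -> be < de -> h al be = k /\ a al be = ga &
      agree q.2.1 (D al) (t q.2.2) /\ v < D al q.2.1]]].
have goodP de : SS de -> exists q, good de q.
  move=> SSde; have dek := SSk SSde.
  have S1st : stationary kappa [set al | (S al /\ x0 < al) /\ de < al].
    exact: (stationary_above O_wo lambda_reg kappa_reg lambda_lt_kappa S0st dek).
  have /(choice_in lambda)[f fP] : forall al, S al /\ de < al -> exists xi, xi < de /\
      forall be, xi < be -> be < de -> h al be = h al de /\ a al be = a al de.
    move=> al [/SSS SSal ltde]; have [_ _ /(_ _ SSde ltde)[xi ? ?]] := lad SSal.
    by exists xi.
  have hP al : S al -> de < al -> [/\ h al de < lambda, de <= a al de & a al de < al].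
    by move=> /SSS SSal ltde; have [/(_ _ ltde)[]] := lad SSal.
  have [|ga gak S2st] := fodor O_wo lambda_reg kappa_reg lambda_lt_kappa (g := a^~ de)
      S1st lambda_lt_kappa.
    by move=> al [[Sal _] ltde]; left; have [] := hP _ Sal ltde.
  have [|k kk S3st] := fodor O_wo lambda_reg kappa_reg lambda_lt_kappa (g := h^~ de)
      S2st lambda_lt_kappa.
    by move=> al [[[Sal _] ltde] _]; right; have [] := hP _ Sal ltde.
  have [|xi1 _ S4st] := fodor O_wo lambda_reg kappa_reg lambda_lt_kappa (g := f)
      S3st dek.
    by move=> al [[[[Sal _] ltde] _] _]; right; have [] := fP _ (conj Sal ltde).
  have := stationary_cofinal O_wo lambda_reg kappa_reg lambda_lt_kappa S4st.
  move=> /Dunb[n [ze [ltn ltze nP]]].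
  have [al0 [[[[[Sal0 _] ltde0] aal0] hal0] fal0] _] := nP _ lt0.
  have [hl dea aal] := hP _ Sal0 ltde0.
  have [_ /(_ _ SSde)] := sepP gak.
  rewrite -{1}aal0 => /(_ dea)[_ [xi2 [wb [lt2 ltwb wbP]]]].
  have lt1 : xi1 < de by rewrite -fal0; have [] := fP _ (conj Sal0 ltde0).
  exists (Order.max xi1 xi2, wb, (n, ze)); split=> /=.
    by split=> //; rewrite gt_max lt1.
  exists k, ga; split=> //; first by rewrite -hal0.
    move=> be w; rewrite gt_max => /andP[_ ltb]; exact: wbP.
  move=> v /nP[al [[[[[Sal ltx0] ltde] aal'] hal] fal] agv].
  exists al; split=> // be; rewrite gt_max => /andP[ltb _] ltbe.
  have [_ /(_ be)] := fP _ (conj Sal ltde); rewrite fal => /(_ ltb ltbe).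
  by rewrite hal aal'.
have /(choice_in ((lambda, lambda), (lambda, lambda)))[q qP] := goodP.
(* The entries of [q de] are regressive or bounded, so four uses of Fodor's lemma fix them on a
   stationary set of [de] of colour [i], not necessarily in [S]. *)
have [|xi xik Q1st] := fodor O_wo lambda_reg kappa_reg lambda_lt_kappa
    (g := fun de => (q de).1.1) Pst lambda_lt_kappa.
  by move=> de [SSde _]; left; have [[]] := qP _ SSde.
have [|wb wbk Q2st] := fodor O_wo lambda_reg kappa_reg lambda_lt_kappa
    (g := fun de => (q de).1.2) Q1st lambda_lt_kappa.
  by move=> de [[SSde _] _]; right; have [[]] := qP _ SSde.
have [|n nk Q3st] := fodor O_wo lambda_reg kappa_reg lambda_lt_kappa
    (g := fun de => (q de).2.1) Q2st lambda_lt_kappa.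
  move=> de [[[SSde _] _] _]; right; have [[_ _ ltn _] _] := qP _ SSde.
  exact: lt_le_trans leeta.
have [|ze zek Q4st] := fodor O_wo lambda_reg kappa_reg lambda_lt_kappa
    (g := fun de => (q de).2.2) Q3st ga0k.
  by move=> de [[[[SSde _] _] _] _]; right; have [[]] := qP _ SSde.
pose Q := [set de | [/\ SS de, col de = i & q de = ((xi, wb), (n, ze))]].
have Qst : stationary kappa Q.
  apply: stationary_sub Q4st; last by move=> de [/SSk].
  move=> de [[[[[SSde colde] e1] e2] e3] e4]; split=> //.
  by move: e1 e2 e3 e4; case: (q de) => [[? ?] [? ?]] /= -> -> -> ->.
(* The point [de0] serves to choose a value [w > wb] whose class is cofinal, before the final [de]
   is chosen. *)
have [de0 [SSde0 colde0 qde0] _] :=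
  (stationary_cofinal O_wo lambda_reg kappa_reg lambda_lt_kappa Qst).2 _ lambda_lt_kappa.
have := qP _ SSde0; rewrite qde0 => -[[/= _ ltwb ltn ltze] [? [? [_ _ _]]]].
move=> /(_ _ ltwb)[al0 [Sal0 ltx0 _ _ [ag0 ltw]]].
have ltnl := lt_le_trans ltn leeta.
set w := D al0 n in ltw.
have ltwl : w < lambda by apply: Dl => //; apply: Sk.
have Xcof : cofinal_in kappa (X ze n w).
  by apply: (x0P _ _ _ ltze ltnl ltwl al0) => //; exact: ltW.
have /(choice_in lambda)[N NP] : forall x, x < kappa -> exists y, X ze n w y /\ x < y.
  move=> x /kappa_limit[y ltxy yk]; have [_ /(_ _ yk)[z Xz leyz]] := Xcof.
  by exists z; split=> //; apply: lt_le_trans leyz.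
(* Closure under [N] makes [de] a limit of the class of [w], so it has a member [be < de] with
   [w < h de be]. *)
have [x y xk yk|de [[SSde colde qde] ltxi deN]] := stationary_closed O_wo lambda_reg
    kappa_reg lambda_lt_kappa (F := fun x _ => N x) Qst _ xik.
  by apply: Xk; exact: (NP _ xk).1.
have := qP _ SSde; rewrite qde => -[_ [k [ga [/= ltk gak pP alP]]]].
have [_ hlim _] := lad SSde; have [xi5 lt5 xi5P] := hlim _ ltwl.
have ltm : Order.max xi xi5 < de by rewrite gt_max ltxi lt5.
set be := N (Order.max xi xi5).
have ltbe : be < de by exact: (deN _ _ ltm ltm).
have [[Sbe agbe Dbe]] := NP _ (lt_trans ltm (SSk SSde)).
rewrite gt_max -/be => /andP[ltxib ltxi5b].
have [phil _] := sepP gak.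
(* Exceeding [w] splits the columns at [n]; exceeding [k] and [phi ga be] gives the two inequalities
   of [guesses]. *)
have [|al [Sal _ ltde alh [agal ltv]]] := alP (Order.max w (Order.max k (phi ga be))).
  by rewrite !gt_max ltwl ltk phil.
move: ltv; rewrite !gt_max => /and3P[ltwD ltkD ltphiD].
have [hE aE] := alh _ ltxib ltbe.
exists be, al; split=> //; first exact: lt_trans ltde.
exists n => //; split.
- by move=> z ltz; rewrite agbe// agal.
- by rewrite Dbe => eD; move: ltwD; rewrite -eD ltxx.
- by rewrite hE ltW.
- by rewrite aE ltW.
- rewrite aE Dbe -colde; apply: pP => //; first exact: ltW.
  by apply/ltW/xi5P.
Qed.

End Guessing.

(** * Ladders outside [SS] *)

Section Matrix.
Context {d : Order.disp_t} {O : orderType d}.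
Hypothesis O_wo : well_order (fun x y : O => x <= y).
Context {lambda kappa : O} {SS : set O}.
Hypothesis lambda_reg : infinite_regular lambda.
Hypothesis kappa_reg : infinite_regular kappa.
Hypothesis lambda_lt_kappa : lambda < kappa.
Hypothesis SS_cf : SS `<=` cf_points kappa lambda.
Implicit Types (x y z u v w al be ga de xi i k : O) (S : set O).

Let SSk : SS `<=` seg kappa.
Proof. by move=> al /SS_cf[]. Qed.

(** The successor of [x] works, since all points of [SS] are limits. *)
Lemma SS_compl_between al x : SS al -> x < al ->
  exists y, [/\ ~ SS y, x < y & y < al].
Proof.
move=> SSal /(SS_limit lambda_reg SS_cf SSal)[z ltxz ltz].
have [|y ltxy ymin] := ex_least O_wo (P := [set y | x < y]); first by exists z.
exists y; split=> //; last exact: le_lt_trans (ymin _ ltxz) ltz.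
move=> SSy; have [w ltxw] := SS_limit lambda_reg SS_cf SSy ltxy.
by rewrite ltNge ymin.
Qed.

Context {h a : O -> O -> O}.
Hypothesis lad : is_ladder (lambda := lambda) (SS := SS) h a.

Lemma ex_ladder_coloring : exists g : O -> O -> O, forall al i v,
  SS al -> i < lambda -> v < lambda ->
  exists be, [/\ ~ SS be, be < al, v <= h al be & g al (h al be) = i].
Proof.
have /(choice_in id)[g gP] : forall al, SS al -> exists g : O -> O, forall i v,
    i < lambda -> v < lambda ->
    exists k, [/\ (exists be, [/\ ~ SS be, be < al & h al be = k]),
      v <= k, k < lambda & g k = i].
  move=> al SSal; apply: (unbounded_fibers O_wo lambda_reg) => v ltv.
  have [hP /(_ _ ltv)[xi ltxi xiP] _] := lad SSal.
  have [y [nSSy ltxy lty]] := SS_compl_between SSal ltxi.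
  exists (h al y); first by exists y.
  by split; [exact/ltW/xiP | have [] := hP _ lty].
exists g => al i v SSal lti ltv.
have [_ [[be [nSS ltbe <-]] lev _ gk]] := gP _ SSal _ _ lti ltv.
by exists be.
Qed.

Context {g : O -> O -> O}.
Hypothesis gP : forall al i v, SS al -> i < lambda -> v < lambda ->
  exists be, [/\ ~ SS be, be < al, v <= h al be & g al (h al be) = i].

(** The last clause keeps one point per value of [h al], so an interval on which [h al] is constant
    contains at most one point below [al]. *)
Definition ladder_part al i : set O := [set be |
  [/\ ~ SS be, g al (h al be) = i &
      forall be', be' < al -> ~ SS be' -> h al be' = h al be -> be <= be']].

Lemma ladder_part_cofinal al i x : SS al -> i < lambda -> x < al ->
  exists be, [/\ ladder_part al i be, be < al & x <= be].
Proof.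
move=> SSal lti ltx; have [hP _ _] := lad SSal.
have [/(lambda_limit lambda_reg)[v lthv ltv] _ _ hmono] := hP _ ltx.
have [be0 [nSS0 lt0 lev0 g0]] := gP SSal lti ltv.
have [|be [ltbe nSS hbe] bemin] := ex_least O_wo
    (P := [set be | [/\ be < al, ~ SS be & h al be = h al be0]]).
  by exists be0.
exists be; split=> //.
  split=> //; first by rewrite hbe.
  by move=> be' lt' nSS' h'; apply: bemin; split=> //; rewrite h'.
rewrite leNgt; apply/negP => /ltW/hmono; rewrite hbe leNgt.
by rewrite (lt_le_trans lthv lev0).
Qed.

Lemma ladder_part_almost_disjoint al al' : SS al -> SS al' -> al < al' ->
  exists2 u, u < al & forall be i, be < al -> ladder_part al' i be -> be <= u.
Proof.
move=> SSal SSal' ltal; have [_ _ /(_ _ SSal ltal)[xi ltxi xiP]] := lad SSal'.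
have [[be0 [i0 [ltxi0 lt0 [nSS0 _ min0]]]]|H] := pselect (exists be i,
    [/\ xi < be, be < al & ladder_part al' i be]); last first.
  exists xi => // be i ltbe Lbe; rewrite leNgt; apply/negP => ltxib.
  by apply: H; exists be, i.
exists (Order.max xi be0); first by rewrite gt_max ltxi.
move=> be i ltbe [nSS _ bemin]; rewrite le_max.
have [//|ltxib] := leP be xi; apply: bemin => //; first exact: lt_trans ltal.
by have [-> _] := xiP _ ltxi0 lt0; have [-> _] := xiP _ ltxib ltbe.
Qed.

End Matrix.

(** * Assembling the matrix *)

Unset Implicit Arguments.
Set Strict Implicit.

Theorem theorem3p4 (d : Order.disp_t) (O : orderType d)
  (O_wo : well_order (fun x y : O => x <= y))
  (lambda kappa : O) (SS : set O)
  (lambda_reg : infinite_regular lambda)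
  (kappa_reg : infinite_regular kappa)
  (lambda_lt_kappa : lambda < kappa)
  (SS_cf : SS `<=` cf_points kappa lambda)
  (SS_stat : stationary kappa SS)
  (SS_nonrefl : nonreflecting kappa SS)
  (c_ex : exists c : O -> O -> O,
     coloring lambda kappa c /\ strongly_unbounded lambda kappa c) :
  (exists (C : set O) (A : O -> O -> set O),
     club kappa C /\ guessing_matrix lambda kappa SS C A) /\
  (is_successor_cardinal lambda kappa \/ weak_power_eq lambda ->
   exists A : O -> O -> set O,
     guessing_matrix lambda kappa SS (seg kappa) A).
Proof.
(* One matrix over all of [kappa] serves both claims. *)
suff [A AP] : exists A, guessing_matrix lambda kappa SS (seg kappa) A.
  split=> [|_]; last by exists A.
  by exists (seg kappa), A; split=> //; split=> //; split=> // x xk; exists x.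
have SSk : SS `<=` seg kappa by move=> al /SS_cf[].
have [h [a lad]] := ex_ladder O_wo SS_cf.
have [col colP] := stationary_partition O_wo lambda_reg kappa_reg lambda_lt_kappa
  SS_cf lad SS_stat.
have /(choice_in (id, fun _ => id))[sep sepP] : forall ga, ga < kappa -> exists fp,
    separates (lambda := lambda) (SS := SS) h col ga fp.1 fp.2.
  move=> ga gak.
  have [phi [p H]] := ex_separates O_wo lambda_reg SS_cf SS_nonrefl col lad gak.
  by exists (phi, p).
have [c [cP cunb]] := c_ex.
have [D [t [eta [ga0 [e DP]]]]] := ex_tight_coloring O_wo lambda_reg kappa_reg
  lambda_lt_kappa cP cunb.
have [g gP] := ex_ladder_coloring O_wo lambda_reg SS_cf lad.
have [_ _ _ ek _] := DP.
pose G := guesses (h := h) (a := a) (phi := fun ga => (sep ga).1)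
  (p := fun ga => (sep ga).2) (D := D) (eta := eta).
pose L := ladder_part (SS := SS) (h := h) (g := g).
exists (fun al i => [set be | be < al /\
  ([/\ SS be, closed_under e al & G i be al] \/ L al i be)]); split.
- move=> al [SSal _]; split=> [i lti|i j lti ltj].
    split=> [be []//|x ltx].
    have [be [Lbe ltbe lex]] := ladder_part_cofinal O_wo lambda_reg lad gP SSal lti ltx.
    by exists be => //; split=> //; right.
  move=> [be [[_ [[SSbe _ Gi]|[nSS gi _]]] [_ [[SSbe' _ Gj]|[nSS' gj _]]]]] //.
    exact: guesses_inj Gi Gj.
  by rewrite -gi -gj.
- move=> S SSS Sst.
  apply: (stationary_intro kappa_reg) => [al [[]]//|F Fk].
  apply: contrapT => H.
  pose S1 := [set al | [/\ S al, lambda < al & forall x y, x < al -> y < al ->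
    Order.max (F x) (e x) < al]].
  have S1st : stationary kappa S1.
    apply: (stationary_restrict O_wo lambda_reg kappa_reg lambda_lt_kappa
      (F := fun x _ => Order.max (F x) (e x)) Sst) => // x y xk _.
    by rewrite gt_max Fk// ek.
  have clos al : S1 al -> closed_under F al /\ closed_under e al.
    by move=> [_ _ cl]; split=> x ltx; have := cl x x ltx ltx; rewrite gt_max => /andP[].
  (* If guessing fails, [iu] records an index and a bound past which no point of [S] is guessed with
     that index. Fodor's lemma fixes both, and [guesses_stationary] above the bound gives a
     contradiction. *)
  have /(choice_in (lambda, lambda))[q qP] : forall al, S1 al -> exists iu,
      [/\ iu.1 < lambda, iu.2 < al &
        forall be, S be -> be < al -> closed_under e al -> G iu.1 be al -> be <= iu.2].
    move=> al S1al; have [Sal ltal _] := S1al.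
    apply: contrapT => H'; apply: H; exists al; split.
    + split; first by split=> //; apply/SSk/SSS.
      move=> i lti; split; first by move=> be [[/ltW]].
      move=> u ubu; rewrite leNgt; apply/negP => ltu.
      apply: H'; exists (i, u); split=> // be Sbe ltbe al_e Gbe.
      by apply: ubu; split=> //; split=> //; left; split=> //; apply: SSS.
    + by exists lambda.
    + by have [] := clos _ S1al.
  have [|i ik S2st] := fodor O_wo lambda_reg kappa_reg lambda_lt_kappa
      (g := fun al => (q al).1) S1st lambda_lt_kappa.
    by move=> al /qP[]; right.
  have [|u uk S3st] := fodor O_wo lambda_reg kappa_reg lambda_lt_kappa
      (g := fun al => (q al).2) S2st lambda_lt_kappa.
    by move=> al [/qP[]]; left.
  have S4st := stationary_above O_wo lambda_reg kappa_reg lambda_lt_kappa S3st uk.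
  have [al0 [[[[S1al0 qi0] _] _] _]] := S4st.2 _ (closed_under_club O_wo lambda_reg
    kappa_reg lambda_lt_kappa (F := id) (fun x => id)).
  have lti : i < lambda by rewrite -qi0; have [] := qP _ S1al0.
  have [|be [al [[[[[Sbe _ _] _] _] ltube] [[[S1al qi] qu] ltual] ltbe Gbe]]] :=
    guesses_stationary O_wo lambda_reg kappa_reg lambda_lt_kappa SS_cf lad sepP DP
      _ S4st lti (colP _ lti).
    by move=> al [[[[/SSS]]]].
  have [_ _ /(_ be Sbe ltbe (clos _ S1al).2)] := qP _ S1al.
  by rewrite qi qu => /(_ Gbe); rewrite leNgt ltube.
- move=> al al' [SSal alk] [SSal' al'k] ltal i i' lti lti'.
  have [u2 lt2 u2P] := ladder_part_almost_disjoint (g := g) lad SSal SSal' ltal.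
  have [u1 lt1 u1P] : exists2 u, u < al & forall be, be < al ->
      closed_under e al' -> G i be al -> G i' be al' -> be <= u.
    have [al'e|nal'e] := pselect (closed_under e al'); last by exists u2.
    have [u ltu uP] := guesses_almost_disjoint O_wo lambda_reg SS_cf lad sepP DP
      SSal SSal' ltal al'e.
    by exists u => // be ltbe _; apply: uP.
  (* Guessed points lie in [SS] and ladder points outside it, so a common point is of the same kind
     for [al] and [al']. *)
  have [|s ssup les] := ex_sup O_wo (u := Order.max u1 u2) (X := [set be | be < al /\
     ([/\ SS be, closed_under e al & G i be al] \/ L al i be)] `&` [set be | be < al' /\
     ([/\ SS be, closed_under e al' & G i' be al'] \/ L al' i' be)]).
    move=> be [[ltbe H] [_ H']]; rewrite le_max.
    case: H' => [[SSbe al'e G']|L']; last by rewrite (u2P _ i') ?orbT.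
    by case: H => [[_ _ G1]|[]//]; rewrite u1P.
  by exists s => //; apply: le_lt_trans les _; rewrite gt_max lt1.
Qed.
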